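(* Let $G$ be a group and let $R$ be a $G$-graded ring. If $(R,G)$ is second strong, then $(R,G)$ is weak if and only if $(R,G)$ is first strong.
   Context: A ring $R$ with unity $1$ is $G$-graded if $R=\bigoplus_{g\in G}R_g$ for additive subgroups $R_g$ with $R_gR_h\subseteq R_{gh}$ for all $g,h\in G$, where $R_gR_h$ denotes the additive subgroup generated by the products $ab$, $a\in R_g$, $b\in R_h$. $supp(R,G)=\{g\in G:R_g\neq\{0\}\}$. $(R,G)$ is second strong if $supp(R,G)$ is a submonoid of $G$ and $R_gR_h=R_{gh}$ for all $g,h\in supp(R,G)$. $(R,G)$ is first strong if $1\in R_gR_{g^{-1}}$ for all $g\in supp(R,G)$. $(R,G)$ is weak if for every $g\in G$, $R_g=\{0\}$ implies $R_{g^{-1}}=\{0\}$. *)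

(* Defs.v *)
From HB Require Import structures.
From mathcomp Require Import all_boot all_algebra.
From mathcomp Require Import boolp classical_sets cardinality fsbigop.

Set Implicit Arguments.
Unset Strict Implicit.
Unset Printing Implicit Defensive.

Import GRing.Theory.
Local Open Scope classical_set_scope.
Local Open Scope ring_scope.

Definition additive_subgroup (R : pzRingType) (A : set R) : Prop :=
  zmod_closed (mem A).

Definition mul_subgroup (R : pzRingType) (A B : set R) : set R :=
  smallest (@additive_subgroup R) [set a * b | a in A & b in B].

(* Finiteness of the support is required separately because a \sum_(g \in _)
   with infinite support is 0 by convention. *)
Definition homogeneous_decomposition (G : groupType) (R : pzRingType)
    (Rg : G -> set R) (x : R) (f : G -> R) : Prop :=
  [/\ forall g, Rg g (f g),
      finite_set [set g | f g <> 0] &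
      x = \sum_(g \in [set: G]) f g].

Definition graded (G : groupType) (R : pzRingType) (Rg : G -> set R) : Prop :=
  [/\ forall g, additive_subgroup (Rg g),
      forall x, exists! f : G -> R, homogeneous_decomposition Rg x f &
      forall g h, mul_subgroup (Rg g) (Rg h) `<=` Rg (g * h)%g].

Definition supp (G : groupType) (R : pzRingType) (Rg : G -> set R) : set G :=
  [set g | Rg g <> [set 0]].

Definition second_strong (G : groupType) (R : pzRingType)
    (Rg : G -> set R) : Prop :=
  monoid_closed (mem (supp Rg)) /\
  forall g h, supp Rg g -> supp Rg h ->
    mul_subgroup (Rg g) (Rg h) = Rg (g * h)%g.

Definition first_strong (G : groupType) (R : pzRingType)
    (Rg : G -> set R) : Prop :=
  forall g, supp Rg g -> mul_subgroup (Rg g) (Rg g^-1%g) 1.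

Definition weak (G : groupType) (R : pzRingType) (Rg : G -> set R) : Prop :=
  forall g, Rg g = [set 0] -> Rg g^-1%g = [set 0].

(* Main.v *)
Require Import Defs.
From mathcomp Require Import all_boot all_algebra.
From mathcomp Require Import boolp classical_sets cardinality fsbigop.

(** In any graded ring [1] lies in [R_e]: if [e_g] are the components of [1] and
    [x] is in [R_h], then the elements [x * e_g] of [R_(hg)] sum to [x], so
    uniqueness of components gives [x = x * e_1]. By distributivity
    [x = x * e_1] for all [x], and [x = 1] yields [1 = e_1]. In a second strong
    ring, weakness puts [g^-1] in the support along with [g], so
    [R_g R_(g^-1) = R_e] contains [1]. Conversely, in a first strong ring
    [R_g = 0] with [g^-1] in the support forces [1] into [R_(g^-1) 0 = 0],
    whence [R = 0]. *)

Import GRing.Theory.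
Local Open Scope classical_set_scope.
Local Open Scope ring_scope.

Section Graded.
Context {G : groupType} {R : pzRingType} {Rg : G -> set R}.
Hypothesis Rgraded : graded Rg.

Lemma additive_subgroup0 (A : set R) : additive_subgroup A -> A 0.
Proof. by case; rewrite inE. Qed.

Lemma graded0 g : Rg g 0.
Proof. by case: Rgraded => subg _ _; apply: additive_subgroup0. Qed.

Lemma gradedM g h x y : Rg g x -> Rg h y -> Rg (g * h)%g (x * y).
Proof.
move=> gx hy; case: Rgraded => _ _; apply.
by apply: sub_gen_smallest; exists x => //; exists y.
Qed.

Lemma homogeneous_decomposition_inj x f1 f2 :
  homogeneous_decomposition Rg x f1 -> homogeneous_decomposition Rg x f2 ->
  f1 = f2.
Proof.
case: Rgraded => _ /(_ x)[f [_ uf]] _ d1 d2.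
by rewrite -(uf _ d1) -(uf _ d2).
Qed.

Lemma homogeneous_decomposition_delta h x : Rg h x ->
  homogeneous_decomposition Rg x (fun g => if g == h then x else 0).
Proof.
move=> hx; split=> [g||].
- by case: eqP => [->|_] //; apply: graded0.
- by apply: (sub_finite_set _ (finite_set1 h)) => g /=; case: eqP.
- rewrite -(fsbig_widen [set h]) ?fsbig_set1 ?eqxx// => g [_ /= /eqP].
  by case: eqP.
Qed.

(** Left multiplication by an element of degree [h] shifts degrees by [h], so degree [g] of the
    product comes from degree [h^-1 * g] of [y]. *)
Lemma homogeneous_decompositionMl h x y f : Rg h x ->
  homogeneous_decomposition Rg y f ->
  homogeneous_decomposition Rg (x * y) (fun g => x * f (h^-1 * g)%g).
Proof.
move=> hx [fg ffin ->]; split=> [g||].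
- by rewrite -{1}(mulVKg h g); apply: gradedM.
(* The new support lies in the preimage of the old one under an injective translation. *)
- apply: (@sub_finite_set _ _ ((fun g => h^-1 * g)%g @^-1` [set g | f g <> 0])).
    by move=> g /= xf f0; apply: xf; rewrite f0 mulr0.
  by apply: finite_preimage => // g1 g2 _ _; apply: mulgI.
- rewrite full_fsbig_distrr; last first.
    by apply: sub_finite_set ffin => g [].
  rewrite (reindex_fsbigT (fun g => h^-1 * g)%g)//.
  by exists (fun g => h * g)%g; [apply: mulVKg | apply: mulKg].
Qed.

Lemma graded1 : Rg 1%g 1.
Proof.
have [_ /(_ 1)[e [e1 _]] _] := Rgraded.
have homE h x : Rg h x -> x * e 1%g = x.
  move=> hx; have := homogeneous_decompositionMl _ _ _ _ hx e1.
  rewrite mulr1 => /homogeneous_decomposition_inj.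
  move=> /(_ _ (homogeneous_decomposition_delta _ _ hx))/(congr1 (@^~ h)).
  by rewrite /= mulVg eqxx.
suff <- : e 1%g = 1 by case: e1.
have [eg efin sume] := e1.
move: sume; rewrite fsbig_supp setTI fsbig_finite// => sume.
(* Both [e 1 = 1 * e 1] and [1] are expanded along [1 = \sum e g]; the sums agree termwise by
   [homE], as [e g] lies in [Rg g]. *)
rewrite -[LHS]mul1r [X in X * _]sume mulr_suml [RHS]sume.
by apply: eq_bigr => g _; apply: homE.
Qed.

Lemma mul_subgroup_set0r (A : set R) : mul_subgroup A [set 0] `<=` [set 0].
Proof.
apply: smallest_sub => [|_ [a _ [_ -> <-]]]; last exact: mulr0.
by split=> [|x y]; rewrite !inE//= => -> ->; rewrite subr0.
Qed.

End Graded.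

Theorem proposition2p19 (G : groupType) (R : pzRingType) (Rg : G -> set R)
    (Rgraded : graded Rg) (Rstrong : second_strong Rg) :
  weak Rg <-> first_strong Rg.
Proof.
split=> [Rweak g suppg | Rfirst g Rg0].
  (* Contrapositive of weakness at [g^-1]. *)
  have suppV : supp Rg g^-1%g by move=> /Rweak; rewrite invgK.
  by case: Rstrong => _ /(_ _ _ suppg suppV) ->; rewrite mulgV; apply: graded1.
apply: contrapT => suppV.
(* The negated goal is literally membership of [g^-1] in the support. *)
have := Rfirst _ suppV; rewrite invgK Rg0 => /mul_subgroup_set0r/= one0.
apply: suppV; apply/seteqP; split=> [x _ /=|_ ->]; last exact: graded0.
by rewrite -[x]mulr1 one0 mulr0.
Qed.
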